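(* Let $H$ be a separable complex Hilbert space and let $A,B$ be two bounded linear operators on $H$ such that $A$ is normal. Assume that $AB$ is hyponormal and that $BA$ is co-hyponormal. Then \[AA^*B=BA^*A \Longleftrightarrow BA \text{ and } AB \text{ are normal.}\]
   Context: A bounded operator $T$ on $H$ is normal if $TT^*=T^*T$. It is hyponormal if $TT^*\leq T^*T$, equivalently $\|T^*x\|\leq\|Tx\|$ for all $x\in H$. It is co-hyponormal if $T^*$ is hyponormal, i.e. $T^*T\leq TT^*$. *)

(* Defs.v *)
From HB Require Import structures.
From mathcomp Require Import all_boot all_order all_algebra.
From mathcomp Require Import complex ring lra.
From mathcomp Require Import all_classical all_reals all_analysis.

Set Implicit Arguments.
Unset Strict Implicit.
Unset Printing Implicit Defensive.

Import Order.TTheory GRing.Theory Num.Theory.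
Import numFieldNormedType.Exports.

Local Open Scope classical_set_scope.
Local Open Scope ring_scope.

(* {dot H for Num.conj} is linear in its first argument and conjugate-linear in
   its second. The norm of a normed module over R[i] takes values in R[i]. *)
HB.mixin Record NormedModule_hasInner (R : realType) (H : Type)
    of CompleteNormedModule R[i] H := {
  inner : {dot H for Num.conj} ;
  inner_norm : forall x : H, `|x| ^+ 2 = inner x x
}.

#[short(type="hilbertType")]
HB.structure Definition Hilbert (R : realType) :=
  { H of NormedModule_hasInner R H & CompleteNormedModule R[i] H }.

Definition separable_space (T : topologicalType) :=
  exists D : set T, countable D /\ dense D.

Section Operators.
Variables (R : realType) (H : hilbertType R).
Implicit Types S T : H -> H.

Definition bounded_op T := exists M : R[i], forall x, `|T x| <= M * `|x|.

(* The adjoint is given pointwise by Riesz representation; adjP below shows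
   that the defining set is inhabited for bounded linear T (on an unbounded T
   the value 0 may be a junk value). *)
Definition adj T : H -> H :=
  fun y => xget 0 [set z | forall x, inner (T x) y = inner x z].

(* The order on R[i] is the partial one: 0 <= z means that z is real and
   nonnegative. *)
Definition op_le S T := forall x, 0 <= inner (T x - S x) x.

Definition normal_op T := T \o adj T = adj T \o T.

Definition hyponormal T := op_le (T \o adj T) (adj T \o T).

Definition cohyponormal T := hyponormal (adj T).

End Operators.

Section Adjoint.
Variables (R : realType) (H : hilbertType R).
Implicit Types (x y z u h : H) (t : R).
Local Open Scope complex_scope.

Let rip x y : R := complex.Re (inner x y).

Let ReM t (c : R[i]) : complex.Re (t%:C * c) = t * complex.Re c.
Proof. by case: c => a b; simpc. Qed.

Let ReiM (c : R[i]) : complex.Re ('i * c) = - complex.Im c.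
Proof. by case: c => a b; simpc. Qed.

Let ripDl x y z : rip (x + y) z = rip x z + rip y z.
Proof. by rewrite /rip linearDl raddfD. Qed.

Let ripC x y : rip x y = rip y x.
Proof.
rewrite /rip hermitian_subproof expr0 mul1r.
by rewrite -[(inner y x)^*%R]/(conjc (inner y x)); case: (inner y x).
Qed.

Let ripDr x y z : rip z (x + y) = rip z x + rip z y.
Proof. by rewrite ripC ripDl !(ripC z). Qed.

Let ripZl t x y : rip (t%:C *: x) y = t * rip x y.
Proof. by rewrite /rip linearZl_LR; exact: ReM. Qed.

Let ripZr t x y : rip x (t%:C *: y) = t * rip x y.
Proof. by rewrite ripC ripZl ripC. Qed.

Let ripNl x y : rip (- x) y = - rip x y.
Proof. by rewrite /rip linearNl raddfN. Qed.

Let ripNr x y : rip x (- y) = - rip x y.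
Proof. by rewrite ripC ripNl ripC. Qed.

Let innerxx x : inner x x = (rip x x)%:C.
Proof. by rewrite /rip RRe_real// -inner_norm realX// normr_real. Qed.

Let rip_ge0 x : 0 <= rip x x.
Proof. by rewrite -lecR -innerxx -inner_norm exprn_ge0. Qed.

Let norm_lt x t : 0 < t -> (`|x| < t%:C) = (rip x x < t ^+ 2).
Proof.
move=> t0; rewrite -ltcR -innerxx -inner_norm rmorphXn.
by rewrite ltr_pXn2r// nnegrE ?normr_ge0// lecR ltW.
Qed.

Let rip_amgm x y t : 0 < t -> 2 * rip x y <= t * rip x x + t^-1 * rip y y.
Proof.
move=> t0; have := rip_ge0 (t%:C *: x - y).
rewrite !(ripDl, ripDr, ripNl, ripNr, ripZl, ripZr) (ripC y x) => ge0.
rewrite -(ler_pM2l t0) mulrDr (mulrA t t^-1) divff ?lt0r_neq0//; lra.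
Qed.

Let bound_rip (T : {linear H -> H}) : bounded_op T ->
  exists2 K : R, 0 < K & forall x, rip (T x) (T x) <= K * rip x x.
Proof.
move=> [M TM]; exists ((complex.Re `|M|) ^+ 2 + 1) => [|x].
  by rewrite ltr_wpDl// sqr_ge0.
have rM : (complex.Re `|M|)%:C = `|M| by rewrite RRe_real ?normr_real.
apply: (@le_trans _ _ (complex.Re `|M| ^+ 2 * rip x x)); last first.
  by rewrite ler_wpM2r ?rip_ge0// lerDl.
rewrite -lecR rmorphM rmorphXn/= rM -!innerxx -!inner_norm -exprMn.
rewrite ler_pXn2r ?nnegrE ?mulr_ge0//.
have := TM x; have [x0|x0] := eqVneq x 0.
  by rewrite x0 linear0 !normr0 !mulr0.
move=> /[dup] le0 /le_trans; apply; rewrite ler_wpM2r//.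
have : 0 <= M * `|x| by apply: le_trans le0.
by rewrite pmulr_lge0 ?normr_gt0// => /ger0_norm ->.
Qed.

Let riesz_real (f : H -> R) :
  (forall x y, f (x + y) = f x + f y) ->
  (forall t x, f (t%:C *: x) = t * f x) ->
  (exists K, forall x, 2 * f x <= rip x x + K) ->
  exists z, forall x, f x = rip x z.
Proof.
move=> fD fZ [K fK].
pose J x := rip x x - 2 * f x.
have infJ : has_inf (range J).
  split; first by exists (J 0), 0.
  by exists (- K) => _ [x _ <-]; rewrite /J; have := fK x; lra.
pose m := inf (range J).
have mJ x : m <= J x by apply: (@ge_inf _ (range J)); [case: infJ|exists x].
have par x y : rip (x - y) (x - y) <= 2 * (J x - m) + 2 * (J y - m).
  have := mJ ((2^-1 : R)%:C *: (x + y)).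
  rewrite /J !(ripDl, ripDr, ripNl, ripNr, ripZl, ripZr, fD, fZ) (ripC y x).
  lra.
have exu n : exists x, J x < m + n.+1%:R^-1.
  have n0 : (0 : R) < n.+1%:R^-1 by rewrite invr_gt0.
  have [_ [x _ <-] Jx] := inf_adherent n0 infJ.
  by exists x.
pose u n := projT1 (cid (exu n)).
have Ju n : J (u n) < m + n.+1%:R^-1 by rewrite /u; case: cid.
have cu : cvg (u @ \oo).
  suff : cauchy (u @ \oo) by exact: cauchy_cvg.
  suff : cauchy_ex (u @ \oo) by exact: cauchy_exP.
  move=> e e0.
  have [t t0 ->] : exists2 t : R, 0 < t & e = t%:C.
    by exists (complex.Re e); [move: e0; rewrite ltcE => /andP[]|rewrite RRe_real ?gtr0_real].
  have : \forall n \near \oo, n.+1%:R^-1 < t ^+ 2 / 4.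
    by apply: near_infty_natSinv_lt (PosNum (_ : 0 < t ^+ 2 / 4)); rewrite divr_gt0 ?exprn_gt0.
  move=> [N _ NP]; exists (u N), N => // n /= Nn.
  rewrite -ball_normE /ball_/= norm_lt//.
  apply: le_lt_trans (par _ _) _.
  have /= := NP N (leqnn _); have /= := NP n Nn; have := Ju N; have := Ju n.
  move: (J _) (J _) (_^-1) (_^-1) (t ^+ 2) => *; lra.
pose z := lim (u @ \oo).
have near_z t : 0 < t -> exists2 x, J x < m + t & rip (z - x) (z - x) < t ^+ 2.
  move=> t0.
  have h1 : \forall n \near \oo, n.+1%:R^-1 < t.
    exact: near_infty_natSinv_lt (PosNum t0).
  have h2 : \forall n \near \oo, `|z - u n| < t%:C.
    by move/cvgrPdist_lt : cu; apply; rewrite ltcR.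
  near \oo => n; exists (u n).
    by apply: lt_trans (Ju n) _; rewrite ltrD2l; near: n.
  by rewrite -norm_lt//; near: n.
have Jz h : J z <= J (z + h).
  apply/ler_addgt0Pr => e e0.
  pose d := Num.min 1 (e / (rip h h + 3)).
  have hh := rip_ge0 h.
  have d0 : 0 < d by rewrite lt_min ltr01/= divr_gt0//; lra.
  have d1 : d <= 1 by rewrite ge_min lexx.
  have de : d * (rip h h + 3) <= e.
    by rewrite -ler_pdivlMr; [rewrite ge_min lexx orbT|lra].
  have [x Jx zx] := near_z d d0.
  have m1 := mJ (x + h).
  have dV : 0 < d^-1 by rewrite invr_gt0.
  have := rip_amgm (x - z) h dV.
  rewrite invrK.
  have q : d^-1 * rip (x - z) (x - z) <= d.
    rewrite ler_pdivrMl// -expr2 ltW//; move: zx.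
    by rewrite !(ripDl, ripDr, ripNl, ripNr) (ripC x z); lra.
  have : J z - J (z + h) = J x - J (x + h) + 2 * rip (x - z) h.
    rewrite /J !(ripDl, ripDr, ripNl, ripNr, fD) (ripC h x) (ripC h z); ring.
  lra.
exists z => h.
have key t : 0 <= t ^+ 2 * rip h h + 2 * t * (rip h z - f h).
  have := Jz (t%:C *: h).
  rewrite /J !(ripDl, ripDr, ripZl, ripZr, fD, fZ) (ripC z h); lra.
have hh := rip_ge0 h.
set a := rip h z - f h in key.
suff : a = 0 by rewrite /a; lra.
have p0 : 0 < rip h h + 1 by lra.
have := key (- a / (rip h h + 1)).
have -> : (- a / (rip h h + 1)) ^+ 2 * rip h h + 2 * (- a / (rip h h + 1)) * a =
  - (a ^+ 2 * (rip h h + 2) / (rip h h + 1) ^+ 2).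
  by field; rewrite lt0r_neq0.
rewrite oppr_ge0 pmulr_lle0 ?invr_gt0 ?exprn_gt0// pmulr_lle0; last lra.
by move=> a2; apply/eqP; rewrite -sqrf_eq0 eq_le a2 sqr_ge0.
Unshelve. all: by end_near. Qed.

Lemma adjP (T : {linear H -> H}) : bounded_op T ->
  forall x y, inner (T x) y = inner x (adj T y).
Proof.
move=> bT x y; rewrite /adj; move: x.
case: xgetP => [z _ //|].
have [K K0 TK] := bound_rip bT.
have [||| z zP] := @riesz_real (fun x => rip (T x) y).
- by move=> u v; rewrite linearD ripDl.
- by move=> t u; rewrite linearZ ripZl.
- exists (K * rip y y) => u.
  have := @rip_amgm (T u) y K^-1; rewrite invr_gt0 invrK => /(_ K0)/le_trans; apply.
  by rewrite lerD2r ler_pdivrMl.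
move/(_ z) => /=; case => x; apply/eqP; rewrite eq_complex; apply/andP; split.
  exact/eqP/zP.
have := zP ('i *: x); rewrite linearZ /rip !linearZl_LR.
by rewrite !ReiM => /oppr_inj ->.
Qed.

End Adjoint.

(* Main.v *)
From HB Require Import structures.
Require Import Defs.
From mathcomp Require Import all_boot all_order all_algebra.
From mathcomp Require Import cyclic separable cyclotomic complex.
From mathcomp Require Import zify ring lra.
From mathcomp Require Import all_classical all_reals all_analysis.

(** Write [P = A^* A = A A^*], [T = B A], [S = A B], so that [A T = S A].

    If [P] commutes with [B], put [D = T T^* - T^* T] and [E = S^* S - S S^*];
    both are nonnegative, and [A^* E A = - P D], [A D A^* = - P E]. Thus [P] and
    [D] are commuting nonnegative operators with [P D <= 0], which forces
    [P D = 0]. Hence [A D = 0] and [P E = 0]. On the kernel of [P] (which is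
    that of [A] and of [A^*]) both [D] and [E] vanish, so [D^2 = 0] and
    [E^2 = 0], and [D] and [E] being selfadjoint they are [0].

    Conversely, if [S] and [T] are normal, the Fuglede-Putnam theorem turns
    [A T = S A] into [A T^* = S^* A], whose adjoint is the wanted identity.
    Fuglede-Putnam itself holds because [N Y = S^* Y - Y T^*] satisfies
    [|1 + t N| <= 1 + O(|t|^2)] for all complex [t] on the space of the [Y] with
    [S Y = Y T]: averaging [w^-1 (1 + w t N)^n] over the roots of unity [w] of
    order [n+1] yields [n |t| |N| <= (1 + c |t|^2)^n], and then [t = r / n] with
    [n] and [r] tending to infinity gives [N = 0]. *)

Set Implicit Arguments.
Unset Strict Implicit.
Unset Printing Implicit Defensive.

Import Order.TTheory GRing.Theory Num.Theory.
Import numFieldNormedType.Exports.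

Local Open Scope ring_scope.

(** * Real inner product and adjoints *)

Section RealInner.
Local Open Scope complex_scope.
Variables (R : realType) (H : hilbertType R).
Implicit Types (x y z : H) (t : R) (S T : {linear H -> H}).

Lemma innerC x y : inner x y = (inner y x)^*%R.
Proof. by rewrite hermitian_subproof expr0 mul1r. Qed.

Definition rdot x y : R := complex.Re (inner x y).

Lemma rdotC x y : rdot x y = rdot y x.
Proof.
by rewrite /rdot innerC -[(inner y x)^*%R]/(conjc (inner y x)); case: (inner y x).
Qed.

Lemma rdotDl x y z : rdot (x + y) z = rdot x z + rdot y z.
Proof. by rewrite /rdot linearDl raddfD. Qed.

Lemma rdotDr x y z : rdot z (x + y) = rdot z x + rdot z y.
Proof. by rewrite rdotC rdotDl !(rdotC z). Qed.

Lemma rdotNl x y : rdot (- x) y = - rdot x y.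
Proof. by rewrite /rdot linearNl raddfN. Qed.

Lemma rdotNr x y : rdot x (- y) = - rdot x y.
Proof. by rewrite rdotC rdotNl rdotC. Qed.

Lemma rdotZl t x y : rdot (t%:C *: x) y = t * rdot x y.
Proof. by rewrite /rdot linearZl_LR/=; case: (inner x y) => a b; simpc. Qed.

Lemma rdotZr t x y : rdot x (t%:C *: y) = t * rdot x y.
Proof. by rewrite rdotC rdotZl rdotC. Qed.

Definition rdotE := (rdotDl, rdotDr, rdotNl, rdotNr, rdotZl, rdotZr).

Lemma normr_rdot x : `|x| ^+ 2 = (rdot x x)%:C.
Proof. by rewrite inner_norm /rdot RRe_real// -inner_norm realX// normr_real. Qed.

Lemma rdot_ge0 x : 0 <= rdot x x.
Proof. by rewrite -lecR -normr_rdot exprn_ge0. Qed.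

Lemma rdot_eq0 x : rdot x x = 0 -> x = 0.
Proof.
by move=> x0; apply/eqP; rewrite -normr_eq0 -sqrf_eq0 normr_rdot x0.
Qed.

Lemma rdot_amgm x y t : 0 < t -> 2 * rdot x y <= t * rdot x x + t^-1 * rdot y y.
Proof.
move=> t0; have := rdot_ge0 (t%:C *: x - y).
rewrite !rdotE (rdotC y x) => ge0.
rewrite -(ler_pM2l t0) mulrDr (mulrA t t^-1) divff ?lt0r_neq0//; lra.
Qed.

Lemma normr_leZ x y t : 0 <= t ->
  (`|x| <= t%:C * `|y|) = (rdot x x <= t ^+ 2 * rdot y y).
Proof.
move=> t0; rewrite -lecR rmorphM rmorphXn/= -!normr_rdot -exprMn.
by rewrite ler_pXn2r// nnegrE ?mulr_ge0// lecR.
Qed.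

Definition bounded_by (K : R) (T : H -> H) := forall x, `|T x| <= K%:C * `|x|.

(** The bound at a nonzero [x] forces the complex constant [M] to be real and nonnegative, so [|M|]
    may replace it; adding 1 makes the constant positive. *)
Lemma bounded_opP T : bounded_op T -> exists2 K : R, 0 < K & bounded_by K T.
Proof.
move=> [M TM]; have [m m0 mM] : exists2 m : R, 0 <= m & m%:C = `|M|.
  exists (complex.Re `|M|); last by rewrite RRe_real ?normr_real.
  by rewrite -lecR RRe_real ?normr_real//; exact: normr_ge0.
exists (m + 1) => [|x]; first by rewrite ltr_wpDl.
rewrite rmorphD/= mM mulrDl mul1r.
have := TM x; have [->|x0] := eqVneq x 0.
  by rewrite linear0 !normr0 !mulr0 addr0.
move=> /[dup] le0 /le_trans; apply.
have : 0 <= M * `|x| by apply: le_trans le0.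
by rewrite pmulr_lge0 ?normr_gt0// => /ger0_norm ->; rewrite lerDl.
Qed.

Lemma bounded_op_comp S T : bounded_op S -> bounded_op T -> bounded_op (S \o T).
Proof.
move=> /bounded_opP[K K0 SK] [M TM]; exists (K%:C * M) => x /=.
by rewrite (le_trans (SK _))// -mulrA ler_pM2l// ltcR.
Qed.

Lemma bounded_op_sub S T : bounded_op S -> bounded_op T -> bounded_op (S \- T).
Proof.
move=> [M SM] [N TN]; exists (M + N) => x /=.
by rewrite mulrDl (le_trans (ler_normB _ _))// lerD.
Qed.

Definition adjoint_pair (T T' : H -> H) :=
  forall x y, inner (T x) y = inner x (T' y).

Lemma inner_inj x y : (forall z, inner z x = inner z y) -> x = y.
Proof.
move=> xy; apply/eqP; rewrite -subr_eq0; apply/eqP/rdot_eq0.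
by rewrite /rdot linearBr/= xy subrr.
Qed.

Lemma adjoint_pair_sym (S T : H -> H) : adjoint_pair S T -> adjoint_pair T S.
Proof. by move=> ST x y; rewrite innerC -ST -innerC. Qed.

Lemma adjoint_pair_rdot (S T : H -> H) : adjoint_pair S T ->
  forall x y, rdot (S x) y = rdot x (T y).
Proof. by move=> ST x y; rewrite /rdot ST. Qed.

Lemma adj_unique T (T' : H -> H) :
  bounded_op T -> adjoint_pair T T' -> adj T = T'.
Proof.
move=> bT TT'; apply/funext => y; apply: inner_inj => x.
by rewrite -adjP// TT'.
Qed.

(** Since [|T' x|^2 = <T (T' x), x>], the inequality of means with weight [K^-2] gives
    [2 |T' x|^2 <= |T' x|^2 + K^2 |x|^2]. *)
Lemma adjoint_pair_bounded T T' :
  adjoint_pair T T' -> bounded_op T -> bounded_op T'.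
Proof.
move=> TT' /bounded_opP[K K0 TK]; exists K%:C => x.
rewrite normr_leZ ?(ltW K0)//.
have := TK (T' x); rewrite normr_leZ ?(ltW K0)// => h.
have KV : 0 < (K ^+ 2)^-1 by rewrite invr_gt0 exprn_gt0.
have := rdot_amgm (T (T' x)) x KV; rewrite invrK.
have : (K ^+ 2)^-1 * rdot (T (T' x)) (T (T' x)) <= rdot (T' x) (T' x).
  by rewrite ler_pdivrMl ?exprn_gt0.
rewrite (adjoint_pair_rdot TT' (T' x) x); lra.
Qed.

Lemma adj_linear T : bounded_op T -> linear (adj T).
Proof.
move=> bT a x y; apply: inner_inj => z.
by rewrite -(adjP bT) !linearDr !linearZr_LR/= !(adjP bT).
Qed.

Lemma ex_adjoint T : bounded_op T -> exists T' : {linear H -> H},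
  [/\ adj T = T', adjoint_pair T T' & bounded_op T'].
Proof.
move=> bT.
pose aT := GRing.isLinear.Build R[i] H H *:%R (adj T) (adj_linear bT).
pose T' : {linear H -> H} := HB.pack (adj T) aT.
have TT' : adjoint_pair T T' by exact: adjP.
by exists T'; split=> //; exact: adjoint_pair_bounded TT' bT.
Qed.

End RealInner.

(** * Commuting nonnegative operators *)

Section Positive.
Local Open Scope complex_scope.
Variables (R : realType) (H : hilbertType R).
Variables (A A' D : {linear H -> H}).
Hypotheses (AA' : adjoint_pair A A') (DD : adjoint_pair D D).
Hypotheses (bA : bounded_op A) (bD : bounded_op D).
Hypothesis PD : forall x, A' (A (D x)) = D (A' (A x)).
Hypothesis D_ge0 : forall x, 0 <= rdot (D x) x.
Hypothesis PD_le0 : forall x, rdot (A (D x)) (A x) <= 0.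

(* The iterates of [y |-> y - e D y] stay bounded, while at each step
   [- <A D y, A y>] increases by at least [2 e |A D y|^2], which does not
   decrease either. *)
Lemma commuting_nonneg_nonpos_mul_eq0 x : A (D x) = 0.
Proof.
have [M M0 DM] := bounded_opP bD; have [K K0 AK] := bounded_opP bA.
have rD u v : rdot (D u) v = rdot u (D v) by exact: adjoint_pair_rdot.
have rA u v : rdot (A u) (A v) = rdot (A' (A u)) v.
  by rewrite rdotC (adjoint_pair_rdot AA') rdotC.
have rADA u v : rdot (A (D u)) (A v) = rdot (A u) (A (D v)).
  by rewrite rA PD rD -rA.
(* With this [e], the operator [e D] lies between 0 and the identity, which makes [f] below a
   contraction. *)
pose e := M^-1; have e0 : 0 < e by rewrite invr_gt0.
have DyM u : rdot (D u) u <= M * rdot u u.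
  have := rdot_amgm (D u) u e0; rewrite invrK.
  have : e * rdot (D u) (D u) <= M * rdot u u.
    rewrite ler_pdivrMl// mulrA -expr2 -normr_leZ ?(ltW M0)//.
  lra.
pose f y := y - e%:C *: D y.
have De y : e * rdot (D y) (D y) <= rdot (D y) y.
  have := D_ge0 (f y); rewrite /f linearB linearZ/= !rdotE (rD (D y) y).
  have : e * (e * rdot (D (D y)) (D y)) <= e * rdot (D y) (D y).
    by rewrite ler_pM2l// ler_pdivrMl.
  lra.
have fle y : rdot (f y) (f y) <= rdot y y.
  rewrite /f !rdotE (rdotC y); have := mulr_ge0 (ltW e0) (D_ge0 y).
  have : e * (e * rdot (D y) (D y)) <= e * rdot (D y) y by rewrite ler_pM2l.
  lra.
pose q y := - rdot (A (D y)) (A y); pose p y := rdot (A (D y)) (A (D y)).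
have q_ge0 y : 0 <= q y by rewrite oppr_ge0.
have fp y : p y <= p (f y).
  rewrite /p /f !(linearB, linearZ)/= !rdotE (rdotC (A (D y)) (A (D (D y)))).
  have := mulr_ge0 (ltW e0) (q_ge0 (D y)).
  have := mulr_ge0 (ltW e0) (mulr_ge0 (ltW e0) (rdot_ge0 (A (D (D y))))).
  rewrite /q; lra.
have fq y : q y + 2 * e * p y <= q (f y).
  have := mulr_ge0 (ltW e0) (mulr_ge0 (ltW e0) (q_ge0 (D y))).
  rewrite /p /q /f !(linearB, linearZ)/= !rdotE (rADA (D y) y); lra.
have iter_f n : [/\ rdot (iter n f x) (iter n f x) <= rdot x x,
    p x <= p (iter n f x) & 2 * e * p x * n%:R <= q (iter n f x)].
  elim: n => [|n [fn pn qn]]; first by rewrite mulr0.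
  split=> /=; first exact: le_trans (fle _) fn.
    exact: le_trans pn (fp _).
  apply: le_trans (fq _); rewrite -[n.+1%:R]natr1 mulrDr mulr1 lerD//.
  by rewrite ler_pM2l// mulr_gt0.
(* Expand [|A D y + A y|^2 >= 0] and bound [|A D y|] and [|A y|] through [K] and [M]. *)
have qK y : q y <= (K ^+ 2 * (M ^+ 2 + 1)) * rdot y y.
  have := rdot_ge0 (A (D y) + A y); rewrite !rdotE (rdotC (A y)).
  have := AK (D y); have := DM y; have := AK y.
  rewrite !normr_leZ ?(ltW K0) ?(ltW M0)// => ? /(ler_wpM2l (sqr_ge0 K)) ? ?.
  have := mulr_ge0 (sqr_ge0 K) (rdot_ge0 y); have := rdot_ge0 (A y).
  have := rdot_ge0 (A (D y)).
  have := mulr_ge0 (sqr_ge0 (K * M)) (rdot_ge0 y).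
  rewrite /q exprMn; lra.
apply: rdot_eq0; apply/eqP; rewrite eq_le rdot_ge0 andbT leNgt; apply/negP => p0.
have ep : 0 < 2 * e * p x by rewrite !mulr_gt0.
have KM0 : 0 <= K ^+ 2 * (M ^+ 2 + 1) by rewrite mulr_ge0 ?addr_ge0 ?sqr_ge0.
have := archi_boundP (divr_ge0 (mulr_ge0 KM0 (rdot_ge0 x)) (ltW ep)).
set n := Num.bound _.
rewrite ltr_pdivrMr// (mulrC n%:R) ltNge => /negP; apply.
have [fn _ qn] := iter_f n; apply: le_trans qn (le_trans (qK _) _).
by rewrite ler_wpM2l.
Qed.

End Positive.

(** * Normality of the products when [P] commutes with [B] *)

Section Commuting.
Variables (R : realType) (H : hilbertType R).
Variables (A A' B B' P : {linear H -> H}).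
Hypotheses (AA' : adjoint_pair A A') (BB' : adjoint_pair B B').
Hypotheses (bA : bounded_op A) (bA' : bounded_op A').
Hypotheses (bB : bounded_op B) (bB' : bounded_op B').
Hypotheses (A_A' : forall x, A (A' x) = P x) (A'_A : forall x, A' (A x) = P x).
Hypothesis PB : forall x, P (B x) = B (P x).

Let D : {linear H -> H} := (B \o (A \o A') \o B') \- (A' \o (B' \o B) \o A).
Let E : {linear H -> H} := (B' \o (A' \o A) \o B) \- (A \o (B \o B') \o A').

Hypothesis D_ge0 : forall x, 0 <= rdot (D x) x.
Hypothesis E_ge0 : forall x, 0 <= rdot (E x) x.

Let adjE := (AA', BB', adjoint_pair_sym AA', adjoint_pair_sym BB').

Let PP : adjoint_pair P P.
Proof. by move=> x y; rewrite -!A'_A !adjE. Qed.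

Let PB' x : P (B' x) = B' (P x).
Proof.
apply: inner_inj => z; have := congr1 (inner^~ x) (PB z).
by rewrite /= !(PP, adjE) => ->.
Qed.

Let PA x : P (A x) = A (P x).
Proof. by rewrite -A_A' A'_A. Qed.

Let PA' x : P (A' x) = A' (P x).
Proof. by rewrite -A'_A A_A'. Qed.

(** Rewriting with these turns [A A'] and [A' A] into [P] and moves each [P] towards the argument,
    so that words in the operators become comparable. *)
Let PE := (A_A', A'_A, PA, PA', PB, PB').

Let kerP x : P x = 0 -> A' x = 0.
Proof.
move=> Px; apply: rdot_eq0.
by rewrite (adjoint_pair_rdot (adjoint_pair_sym AA')) A_A' Px /rdot linear0r.
Qed.

Let DD : adjoint_pair D D.
Proof. by move=> x y; rewrite /D/= linearBl linearBr/= !adjE. Qed.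

Let EE : adjoint_pair E E.
Proof. by move=> x y; rewrite /E/= linearBl linearBr/= !adjE. Qed.

Let PD x : P (D x) = D (P x).
Proof. by rewrite /D/= linearB !PE. Qed.

Let A'EA x : A' (E (A x)) = - P (D x).
Proof. by rewrite /E/D/= !linearB/= !PE opprK addrC. Qed.

Let ADA' x : A (D (A' x)) = - P (E x).
Proof. by rewrite /E/D/= !linearB/= !PE opprK addrC. Qed.

(** The sign condition holds because [<A D y, A y> = <P D y, y> = - <E (A y), A y>]. *)
Let AD0 x : A (D x) = 0.
Proof.
apply: (commuting_nonneg_nonpos_mul_eq0 AA' DD) => // [|y|y].
- by do !(apply: bounded_op_sub || apply: bounded_op_comp).
- by rewrite !A'_A PD.
- rewrite (adjoint_pair_rdot AA') A'_A -(adjoint_pair_rdot PP).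
  rewrite -[P (D y)]opprK -A'EA rdotNl oppr_le0.
  by rewrite (adjoint_pair_rdot (adjoint_pair_sym AA')).
Qed.

Let D0 x : D x = 0.
Proof.
have PDx : P (D x) = 0 by rewrite -A'_A AD0 linear0.
(* Both terms of [D] kill [D x], as [P B' D x = B' P D x = 0] and [A D x = 0]. *)
have DDx : D (D x) = 0.
  have DE y : D y = B (P (B' y)) - A' (B' (B (A y))) by rewrite /D/= A_A'.
  by rewrite DE PB' PDx AD0 !linear0 addr0.
by apply: rdot_eq0; rewrite (adjoint_pair_rdot DD) DDx /rdot linear0r.
Qed.

Let E0 x : E x = 0.
Proof.
have PEx : P (E x) = 0 by rewrite -[LHS]opprK -ADA' AD0 oppr0.
have EEx : E (E x) = 0.
  have EE' y : E y = B' (P (B y)) - A (B (B' (A' y))) by rewrite /E/= A'_A.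
  by rewrite EE' PB PEx kerP// !linear0 addr0.
by apply: rdot_eq0; rewrite (adjoint_pair_rdot EE) EEx /rdot linear0r.
Qed.

Lemma normal_of_commute :
  (forall x, B (A (A' (B' x))) = A' (B' (B (A x)))) /\
  (forall x, A (B (B' (A' x))) = B' (A' (A (B x)))).
Proof. by split=> x; [|symmetry]; apply: subr0_eq; [exact: D0|exact: E0]. Qed.

End Commuting.

(** * The Fuglede-Putnam theorem *)

Section RootsOfUnity.
Variable C : numClosedFieldType.

(** In characteristic 0 the polynomial [X^n - 1] is separable, hence has [n] distinct roots, and
    [has_prim_root] finds a primitive one among them. *)
Lemma ex_prim_root n : (0 < n)%N -> exists z : C, n.-primitive_root z.
Proof.
move=> n_gt0.
have [rs rsE] : exists rs : seq C, 'X^n - 1 = \prod_(w <- rs) ('X - w%:P).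
  have [rs] := closed_field_poly_normal ('X^n - 1 : {poly C}).
  by rewrite (monicP (monicXnsubC 1 n_gt0)) scale1r; exists rs.
suff /hasP[z _ zP] : has n.-primitive_root rs by exists z.
apply: has_prim_root => //.
- by apply/allP => w; rewrite unity_rootE -root_prod_XsubC -rsE rootE !hornerE
    subr_eq0.
- rewrite -separable_prod_XsubC -rsE separable_Xn_sub_1//.
  by rewrite pnatr_eq0 -lt0n.
- by rewrite -ltnS -(size_prod_XsubC rs id) -rsE size_XnsubC.
Qed.

Lemma norm_prim_root n (z : C) : n.-primitive_root z -> `|z| = 1.
Proof.
move=> zP; apply/eqP; rewrite -(@pexpr_eq1 _ _ n) ?normr_ge0//.
  by rewrite -normrX prim_expr_order// normr1.
exact: prim_order_gt0 zP.
Qed.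

(** A geometric sum of ratio [z ^+ m], which is 1 exactly when [n] divides [m]. *)
Lemma sum_prim_root n (z : C) m : n.-primitive_root z ->
  \sum_(k < n) (z ^+ k) ^+ m = if (n %| m)%N then n%:R else 0.
Proof.
move=> zP; under eq_bigr do rewrite exprAC.
rewrite (prim_order_dvd zP); case: eqP => [zm|/eqP zm].
  rewrite (eq_bigr (fun=> 1)) => [|k _]; last by rewrite zm expr1n.
  by rewrite sumr_const card_ord.
apply: (mulfI (_ : z ^+ m - 1 != 0)); first by rewrite subr_eq0.
by rewrite -subrX1 exprAC (prim_expr_order zP) expr1n subrr mulr0.
Qed.

Variables (V : lmodType C) (N : {linear V -> V}).

Let F (t : C) (Y : V) := Y + t *: N Y.

Lemma iter_idDZ t n X :
  iter n (F t) X = \sum_(m < n.+1) (t ^+ m *+ 'C(n, m)) *: iter m N X.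
Proof.
elim: n => [|n IHn].
  by rewrite big_ord_recl big_ord0 /= addr0 expr0 scale1r.
rewrite iterS IHn /F linear_sum scaler_sumr.
rewrite [RHS]big_ord_recl/= bin0.
under [X in _ = _ + X]eq_bigr => i _.
  rewrite /bump/= add1n binS mulrnDr scalerDl; over.
rewrite big_split/= addrA; congr (_ + _).
  rewrite big_ord_recl/= bin0; congr (_ + _).
  by rewrite [RHS]big_ord_recr/= bin_small// mulr0n scale0r addr0.
by apply: eq_bigr => i _; rewrite linearZ/= scalerA exprS mulrnAr.
Qed.

(* The powers of [z] occurring in the sum cancel except that of [N X]. *)
Lemma sum_prim_root_iter n (z : C) t X : (0 < n)%N -> n.+1.-primitive_root z ->
  \sum_(k < n.+1) (z ^+ k) ^+ n *: iter n (F (z ^+ k * t)) X =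
  (n.+1%:R * (t *+ n)) *: N X.
Proof.
move=> n0 zP; under eq_bigr do rewrite iter_idDZ scaler_sumr.
rewrite exchange_big/=.
rewrite (bigD1 (Ordinal (_ : 1 < n.+1)%N))//= [X in _ + X]big1 ?addr0 => [|m m1].
  under eq_bigr => k _.
    rewrite bin1 !expr1 scalerA mulrnAr mulrA -exprSr -mulrnAr; over.
  by rewrite -scaler_suml -mulr_suml sum_prim_root// dvdnn.
under eq_bigr => k _.
  rewrite scalerA exprMn mulrnAr mulrA -exprD -mulrnAr; over.
rewrite -scaler_suml -mulr_suml sum_prim_root// ifF ?mul0r ?scale0r//.
(* As [0 < n <= n + m <= 2 n], the only multiple of [n + 1] that [n + m] can be is [n + 1] itself,
   which means [m = 1]. *)
apply/negP => /dvdnP[q nm].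
have {}m1 : m != 1%N :> nat by [].
case: q nm m1 => [|[|q]]; have := ltn_ord m; nia.
Qed.

End RootsOfUnity.

(** * The norm of [H] as a real number *)

Section HilbertNorm.
Local Open Scope complex_scope.
Variables (R : realType) (H : hilbertType R).
Implicit Types (x y : H).

Definition hnorm x : R := complex.Re `|x|.

Lemma hnormE x : `|x| = (hnorm x)%:C.
Proof. by rewrite /hnorm RRe_real// normr_real. Qed.

Lemma hnorm_ge0 x : 0 <= hnorm x.
Proof. by rewrite -lecR -hnormE; exact: normr_ge0. Qed.

Lemma hnorm_sqr x : hnorm x ^+ 2 = rdot x x.
Proof. by apply: complexI; rewrite rmorphXn/= -hnormE normr_rdot. Qed.

Lemma hnormD x y : hnorm (x + y) <= hnorm x + hnorm y.
Proof. by rewrite -lecR rmorphD/= -!hnormE ler_normD. Qed.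

Lemma hnormZ (t : R[i]) (s : R) x : `|t| = s%:C -> hnorm (t *: x) = s * hnorm x.
Proof. by move=> ts; apply: complexI; rewrite rmorphM/= -!hnormE normrZ ts. Qed.

Lemma hnorm_sum n (f : 'I_n -> H) :
  hnorm (\sum_(i < n) f i) <= \sum_(i < n) hnorm (f i).
Proof.
rewrite -lecR raddf_sum/= -hnormE; apply: le_trans (ler_norm_sum _ _ _) _.
by apply: ler_sum => i _; rewrite hnormE.
Qed.

Lemma bounded_byP K (T : H -> H) :
  bounded_by K T <-> forall x, hnorm (T x) <= K * hnorm x.
Proof.
by split=> TK x; have := TK x; rewrite !hnormE -rmorphM/= lecR.
Qed.

End HilbertNorm.

(** * Growth estimates for the commutator map *)

Section FugledePutnam.
Local Open Scope complex_scope.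
Variables (R : realType) (H : hilbertType R).

(** The operator [t S' - t^* S] is skew-adjoint, so [Re <x, z> = 0] and [|x + z|^2 = |x|^2 + |z|^2
    <= (1 + 4 K^2 s^2) |x|^2], below the square of the stated factor. *)
Lemma hnorm_skew_perturb (S S' : {linear H -> H}) (K : R) (t : R[i]) (s : R) x :
  adjoint_pair S S' -> bounded_by K S -> bounded_by K S' -> 0 <= K ->
  `|t| = s%:C -> 0 <= s ->
  let z := t *: S' x - t^*%C *: S x in
  hnorm z <= 2 * K * s * hnorm x /\
  hnorm (x + z) <= (1 + 2 * K ^+ 2 * s ^+ 2) * hnorm x.
Proof.
move=> SS' /bounded_byP SK /bounded_byP S'K K0 ts s0 z.
have ts' : `|t^*%C| = s%:C by rewrite -ts; exact: norm_conjC.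
have zx : hnorm z <= 2 * K * s * hnorm x.
  apply: le_trans (hnormD _ _) _; rewrite -scaleNr.
  rewrite (hnormZ _ ts) (hnormZ _ (_ : _ = s%:C)) ?normrN//.
  by have := ler_wpM2l s0 (SK x); have := ler_wpM2l s0 (S'K x); lra.
split=> //.
have xz : rdot x z = 0.
  rewrite /z rdotDr rdotNr /rdot !linearZr_LR/= -SS' (innerC (S x)).
  case: (inner x (S x)) => a b; case: t {ts ts' z zx} => c d /=; ring.
move: zx xz; move: z => {}z zx xz; have x0 := hnorm_ge0 x.
rewrite -(ler_pXn2r (isT : 0 < 2)%N) ?nnegrE ?hnorm_ge0//; last first.
  by rewrite mulr_ge0// addr_ge0// mulr_ge0 ?sqr_ge0// mulr_ge0 ?sqr_ge0.
rewrite hnorm_sqr !rdotE (rdotC z) xz -!hnorm_sqr addr0 add0r.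
have : hnorm z ^+ 2 <= (2 * K * s * hnorm x) ^+ 2.
  by rewrite ler_pXn2r// nnegrE ?hnorm_ge0// !mulr_ge0.
have := sqr_ge0 (2 * K ^+ 2 * s ^+ 2 * hnorm x).
rewrite !exprMn; lra.
Qed.

Variables (S S' T T' : {linear H -> H}) (K : R).
Hypotheses (SS' : adjoint_pair S S') (TT' : adjoint_pair T T').
Hypotheses (K0 : 0 <= K) (SK : bounded_by K S) (S'K : bounded_by K S').
Hypotheses (TK : bounded_by K T) (T'K : bounded_by K T').
Hypothesis nS : forall x, S (S' x) = S' (S x).
Hypothesis nT : forall x, T (T' x) = T' (T x).

(** Defined on all functions, which form a module over [R[i]], so that the root-of-unity identity
    applies. *)
Let N (Y : H -> H) : H -> H := (S' \o Y) - (Y \o T').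

Let N_linear : linear N.
Proof.
move=> a Y Z; apply/funext => x.
rewrite /N !fctE/= linearD linearZ/=.
rewrite scalerBr opprD !addrA; congr (_ - _).
by rewrite addrAC.
Qed.

(** The product [U Y V] contributes [(1 + 2 K^2 s^2)^2] and the correction [4 K^2 s^2]; then
    [s^4 <= s^2] is applied. *)
Let c := 8 * K ^+ 2 + 4 * K ^+ 4.

(* Since [S Y = Y T], [Y + t N Y] differs by [O(|t|^2)] from [U Y V] with
   [U = 1 + (t S' - t^* S)] and [V = 1 - (t T' - t^* T)], and skew-adjoint
   perturbations of the identity only change norms by [O(|t|^2)]. *)
Lemma commutator_step (Y : {linear H -> H}) (L s : R) (t : R[i]) :
  (forall x, S (Y x) = Y (T x)) -> 0 <= L -> bounded_by L Y ->
  `|t| = s%:C -> 0 <= s <= 1 ->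
  bounded_by (L * (1 + c * s ^+ 2)) ((Y : H -> H) + t *: N Y).
Proof.
move=> SY L0 /bounded_byP YL ts /andP[s0 s1]; apply/bounded_byP => x.
pose v := - t *: T' x - (- t)^*%C *: T x.
have [vx xv] : hnorm v <= 2 * K * s * hnorm x /\
    hnorm (x + v) <= (1 + 2 * K ^+ 2 * s ^+ 2) * hnorm x.
  by apply: hnorm_skew_perturb => //; rewrite normrN.
pose u y := t *: S' y - t^*%C *: S y.
have [uv _] : hnorm (u (Y v)) <= 2 * K * s * hnorm (Y v) /\ _ :=
  hnorm_skew_perturb (Y v) SS' SK S'K K0 ts s0.
have [_ yu] : _ /\ hnorm (Y (x + v) + u (Y (x + v))) <=
   (1 + 2 * K ^+ 2 * s ^+ 2) * hnorm (Y (x + v)) :=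
  hnorm_skew_perturb (Y (x + v)) SS' SK S'K K0 ts s0.
have uD a b : u (a + b) = u a + u b.
  by rewrite /u !linearD/= addrACA.
(* Here [x + v] is [V x], and [u (Y v)] is the second-order part of [U Y V]; the terms in [t^*]
   cancel by [SY]. *)
have -> : ((Y : H -> H) + t *: N Y) x = Y (x + v) + u (Y (x + v)) - u (Y v).
  rewrite (linearD Y x v) uD addrA addrK /u /v /N !fctE/=.
  rewrite rmorphN/= !scaleNr opprK scalerBr (linearD Y).
  rewrite (linearN Y) !(linearZ_LR Y)/=.
  rewrite SY -!addrA.
  by congr (_ + _); rewrite addrC; congr (_ + _); rewrite addrCA subrr addr0.
apply: le_trans (hnormD _ _) _; rewrite -scaleN1r.
rewrite (hnormZ _ (_ : _ = 1%:C)) ?normrN1// mul1r.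
have x0 := hnorm_ge0 x.
have uYv : hnorm (u (Y v)) <= 4 * K ^+ 2 * s ^+ 2 * L * hnorm x.
  have := ler_wpM2l (mulr_ge0 (mulr_ge0 (ler0n R 2) K0) s0) (YL v).
  have := ler_wpM2l (mulr_ge0 (mulr_ge0 (mulr_ge0 (ler0n R 2) K0) s0) L0) vx.
  lra.
pose a := 1 + 2 * K ^+ 2 * s ^+ 2.
have a0 : 0 <= a by rewrite addr_ge0// mulr_ge0 ?sqr_ge0// mulr_ge0 ?sqr_ge0.
rewrite -/a in xv yu.
have Yxv : hnorm (Y (x + v) + u (Y (x + v))) <= a ^+ 2 * L * hnorm x.
  have := ler_wpM2l a0 (YL (x + v)).
  have := ler_wpM2l (mulr_ge0 a0 L0) xv; lra.
have s2 : s ^+ 4 <= s ^+ 2 by rewrite ler_wiXn2l.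
have := ler_wpM2l (mulr_ge0 (mulr_ge0 (exprn_ge0 4 K0) L0) x0) s2.
rewrite /c; rewrite /a in Yxv; lra.
Qed.

Variables (X : {linear H -> H}) (L : R).
Hypotheses (L0 : 0 <= L) (XL : bounded_by L X).
Hypothesis SX : forall x, S (X x) = X (T x).

Let c0 : 0 <= c.
Proof. by rewrite addr_ge0// mulr_ge0// exprn_ge0. Qed.

(** Normality of [S] and [T] makes [N] preserve the relation [S Y = Y T], so [commutator_step] can
    be iterated. *)
Lemma commutator_iter n (s : R) (t : R[i]) : `|t| = s%:C -> 0 <= s <= 1 ->
  exists Y : {linear H -> H},
  [/\ iter n (fun Y => Y + t *: N Y) (X : H -> H) = Y,
     forall x, S (Y x) = Y (T x) & bounded_by (L * (1 + c * s ^+ 2) ^+ n) Y].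
Proof.
move=> ts s01; elim: n => [|n [Y [iterY SY YL]]].
  by exists X; rewrite expr0 mulr1.
exists (Y \+ t \*: ((S' \o Y) \- (Y \o T'))); split.
- by rewrite iterS iterY.
- by move=> x /=; rewrite (linearD S) (linearZ_LR S) (linearB S)/= nS !SY nT.
- rewrite exprSr mulrA; apply: (commutator_step SY _ YL ts s01).
  by rewrite mulr_ge0// exprn_ge0// addr_ge0// mulr_ge0// sqr_ge0.
Qed.

(** Take norms in [sum_prim_root_iter]: each of the [n + 1] summands obeys the same bound because
    [|z^k s| = s], and the factor [n + 1] cancels. *)
Let commutator_bound n (s : R) x : (0 < n)%N -> 0 <= s <= 1 ->
  n%:R * s * hnorm (N X x) <= L * (1 + c * s ^+ 2) ^+ n * hnorm x.
Proof.
move=> n0 s01; have [z zP] := ex_prim_root R[i] (ltn0Sn n).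
pose aN := GRing.isLinear.Build R[i] (H -> H) (H -> H) *:%R N N_linear.
pose NL : {linear (H -> H) -> (H -> H)} := HB.pack N aN.
have := sum_prim_root_iter NL s%:C (X : H -> H) n0 zP.
move=> /(congr1 (fun f : H -> H => hnorm (f x))); rewrite fct_sumE.
have cE : `|n.+1%:R * (s%:C *+ n)| = (n.+1%:R * (n%:R * s))%:C.
  have [s0 _] := andP s01.
  rewrite ger0_norm; last by rewrite mulr_ge0// mulrn_wge0// lecR.
  by rewrite !rmorphM/= !rmorph_nat -[s%:C *+ n]mulr_natl.
have -> : ((n.+1%:R * (s%:C *+ n)) *: NL (X : H -> H)) x =
    (n.+1%:R * (s%:C *+ n)) *: N X x by [].
rewrite (hnormZ _ cE) -mulrA => e.
rewrite -(ler_pM2l (ltr0Sn R n)) -e; apply: le_trans (hnorm_sum _) _.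
rewrite mulr_natl -[X in _ *+ X]card_ord -sumr_const.
apply: ler_sum => k _.
have z1 : `|z ^+ k| = 1 by rewrite normrX (norm_prim_root zP) expr1n.
have zs : `|z ^+ k * s%:C| = s%:C.
  by rewrite normrM z1 mul1r ger0_norm// lecR; case/andP: s01.
have [Y [YE _ /bounded_byP YL]] := commutator_iter n zs s01.
have -> : ((z ^+ k) ^+ n *:
    iter n (fun Y => Y + (z ^+ k * s%:C) *: NL Y) (X : H -> H)) x =
    (z ^+ k) ^+ n *: Y x by rewrite -YE.
by rewrite (hnormZ _ (_ : _ = 1%:C)) ?mul1r// normrX z1 expr1n.
Qed.

Lemma fuglede_putnam_bounded_by x : S' (X x) = X (T' x).
Proof.
suff: hnorm (N X x) = 0.
  move=> NX0; apply/eqP; rewrite -subr_eq0 -normr_eq0; apply/eqP.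
  by rewrite hnormE [hnorm _]NX0.
set a := hnorm _; have a0 : 0 <= a by exact: hnorm_ge0.
apply/eqP; rewrite eq_le a0 andbT leNgt; apply/negP => agt0.
pose b := L * expR 1 * hnorm x.
have ra (r : nat) : (0 < r)%N -> r%:R * a <= b.
  (* With [n = r^2 j] steps of size [s = 1 / (r j)], [n s = r] while [n c s^2 = c / j <= 1]; hence
     [(1 + c s^2)^n <= e], uniformly in [r]. *)
  move=> r0; pose j := (Num.bound c).+1; pose s : R := (r%:R * j%:R)^-1.
  have j1 : c <= j%:R.
    by rewrite (le_trans (ltW (archi_boundP c0)))// ler_nat.
  have rR : 1 <= r%:R :> R by rewrite ler1n.
  have jR : 1 <= j%:R :> R by rewrite ler1n.
  have r00 : r%:R != 0 :> R by rewrite lt0r_neq0// (lt_le_trans ltr01).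
  have j00 : j%:R != 0 :> R by rewrite lt0r_neq0// (lt_le_trans ltr01).
  have s01 : 0 <= s <= 1.
    rewrite invr_ge0 mulr_ge0//= invf_le1 ?mulr_gt0 ?(lt_le_trans ltr01)//.
    by rewrite mulr_ege1.
  have := @commutator_bound (r ^ 2 * j)%N s x.
  rewrite muln_gt0 expn_gt0 r0/= => /(_ isT s01).
  have -> : (r ^ 2 * j)%:R * s = r%:R :> R.
    by rewrite natrM natrX /s; field; rewrite r00 j00.
  move=> /le_trans; apply; rewrite ler_wpM2r ?hnorm_ge0// ler_wpM2l//.
  have h : 1 + c * s ^+ 2 <= expR (c * s ^+ 2) by exact: expR_ge1Dx.
  apply: (@le_trans _ _ (expR (c * s ^+ 2) ^+ (r ^ 2 * j))).
    by rewrite lerXn2r ?nnegrE ?expR_ge0// addr_ge0// mulr_ge0// sqr_ge0.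
  rewrite -expRM_natl ler_expR natrM natrX /s.
  have -> : (r%:R ^+ 2 * j%:R) * (c * (r%:R * j%:R)^-1 ^+ 2) = c / j%:R :> R.
    by field; rewrite r00 j00.
  by rewrite ler_pdivrMr ?mul1r// (lt_le_trans ltr01).
have b0 : 0 <= b by rewrite mulr_ge0 ?hnorm_ge0// mulr_ge0 ?expR_ge0.
have := archi_boundP (divr_ge0 b0 a0).
set m := Num.bound _; rewrite ltr_pdivrMr// ltNge => /negP; apply.
(* The Archimedean bound may be 0, a case outside [ra]. *)
case: m => [|m]; last exact: ra.
by rewrite mul0r.
Qed.

End FugledePutnam.

Theorem fuglede_putnam (R : realType) (H : hilbertType R)
    (S S' T T' X : {linear H -> H}) :
  adjoint_pair S S' -> adjoint_pair T T' ->
  bounded_op S -> bounded_op T -> bounded_op X ->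
  S \o S' = S' \o S -> T \o T' = T' \o T ->
  S \o X = X \o T -> S' \o X = X \o T'.
Proof.
move=> SS' TT' bS bT bX nS nT SX.
have [K1 K1_gt0 SK] := bounded_opP bS.
have [K2 K2_gt0 S'K] := bounded_opP (adjoint_pair_bounded SS' bS).
have [K3 K3_gt0 TK] := bounded_opP bT.
have [K4 K4_gt0 T'K] := bounded_opP (adjoint_pair_bounded TT' bT).
have [L L_gt0 XL] := bounded_opP bX.
have le_bound K K' (Y : H -> H) : K <= K' -> bounded_by K Y -> bounded_by K' Y.
  move=> KK' YK x; apply: le_trans (YK x) _.
  by rewrite ler_wpM2r// lecR.
(* The sum of the four positive constants serves as a common bound. *)
apply/funext => x; apply: (@fuglede_putnam_bounded_by _ _ S S' T T'
  (K1 + K2 + K3 + K4) SS' TT' _ _ _ _ _ _ _ X L (ltW L_gt0) XL) => [|||||y|y|y].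
- lra.
- by apply: le_bound SK; lra.
- by apply: le_bound S'K; lra.
- by apply: le_bound TK; lra.
- by apply: le_bound T'K; lra.
- exact: (congr1 (@^~ y) nS).
- exact: (congr1 (@^~ y) nT).
- exact: (congr1 (@^~ y) SX).
Qed.

Theorem theorem2p1 (R : realType) (H : hilbertType R) (sepH : separable_space H)
    (A B : {linear H -> H}) (bA : bounded_op A) (bB : bounded_op B)
    (nA : normal_op A) (hAB : hyponormal (A \o B))
    (hBA : cohyponormal (B \o A)) :
  A \o adj A \o B = B \o adj A \o A <->
  normal_op (B \o A) /\ normal_op (A \o B).
Proof.
have [A' [adjA AA' bA']] := ex_adjoint bA.
have [B' [adjB BB' bB']] := ex_adjoint bB.
have bAB : bounded_op (A \o B) by exact: bounded_op_comp.
have bBA : bounded_op (B \o A) by exact: bounded_op_comp.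
have bA'B' : bounded_op (A' \o B') by exact: bounded_op_comp.
have AB_pair : adjoint_pair (A \o B) (B' \o A').
  by move=> x y; rewrite /= AA' BB'.
have BA_pair : adjoint_pair (B \o A) (A' \o B').
  by move=> x y; rewrite /= BB' AA'.
have adjAB : adj (A \o B) = B' \o A' by exact: adj_unique.
have adjBA : adj (B \o A) = A' \o B' by exact: adj_unique.
(* Co-hyponormality of [B \o A] is stated through its adjoint, so the adjoint of that adjoint has to
   be identified. *)
have adjA'B' : adj (A' \o B') = B \o A.
  by apply: adj_unique => //; exact: adjoint_pair_sym.
have Re_ge0 (c : complex R) : 0 <= c -> 0 <= complex.Re c.
  by rewrite lecE => /andP[].
rewrite /normal_op adjA in nA; rewrite /normal_op adjA adjAB adjBA.
have {}nA x : A (A' x) = A' (A x) by exact: (congr1 (@^~ x) nA).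
split=> [PB|[nBA nAB]].
  have {}PB x : (A' \o A) (B x) = B ((A' \o A) x).
    by have /= := congr1 (@^~ x) PB; rewrite nA.
  have [x|x|nBA nAB] := @normal_of_commute _ _ A A' B B' (A' \o A) AA' BB'
      bA bA' bB bB' nA (fun=> erefl) PB.
  - move: hBA; rewrite /cohyponormal /hyponormal adjBA adjA'B' => hBA.
    exact: Re_ge0 (hBA x).
  - by move: hAB; rewrite /hyponormal adjAB => hAB; exact: Re_ge0 (hAB x).
  - by split; apply/funext.
have AT' : (B' \o A') \o A = A \o (A' \o B').
  exact: (fuglede_putnam AB_pair BA_pair).
(* The adjoint of [AT'] reads [A' A B = B A A']; normality of [A] swaps the factors. *)
apply/funext => x; apply: inner_inj => z /=.
have /= := congr1 (fun f : H -> H => inner (f z) x) AT'.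
by rewrite nA !(AA', BB', adjoint_pair_sym AA', adjoint_pair_sym BB') nA => ->.
Qed.
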